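(* Let $t\geq 2$ and let $P$ be a sunflower $t$-pattern. Then the number of $t$-dimensional Latin matrices of order $n$ that avoid $P$ is $O(1)^{n^{t-1}}$; that is, there is a constant $c$ depending only on $P$ such that for every $n$ this number is at most $c^{n^{t-1}}$.
   Context: A $t$-dimensional matrix of size $n_1\times\dots\times n_t$ has entries $M_{i_1,\dots,i_t}$ with $1\le i_r\le n_r$. For $r\in[t]$ and $1\le j\le n_r$, the $(r,j)$-slice of $M$ is the $(t-1)$-dimensional matrix obtained by fixing the $r$-th index equal to $j$. A submatrix of $M$ of size $m_1\times\dots\times m_t$ is obtained by choosing, for each coordinate $r$, indices $1\le \sigma_r(1)<\dots<\sigma_r(m_r)\le n_r$ and taking $Q_{j_1,\dots,j_t}=M_{\sigma_1(j_1),\dots,\sigma_t(j_t)}$. A $t$-pattern is a $t$-dimensional $0$--$1$ matrix $P$ such that any two entries equal to $1$ have index tuples that are either equal or differ in at least two positions. A $t$-pattern $P$ is a sunflower $t$-pattern if there exist a set $S\subseteq[t]$ and indices $(c_s)_{s\in S}$ such that whenever $P_{i_1,\dots,i_t}=P_{j_1,\dots,j_t}=1$ with $(i_1,\dots,i_t)\neq(j_1,\dots,j_t)$, we have $i_s=j_s=c_s$ for all $s\in S$ and $i_s\neq j_s$ for all $s\notin S$. A $t$-dimensional matrix $M$ avoids $P$ if $M$ has no submatrix $Q$ of the same dimensions as $P$ with $P\leq Q$ entrywise. The $t$-dimensional Latin matrices of order $n$ are $n\times\dots\times n$ $0$--$1$ matrices defined inductively: the $2$-dimensional ones are the $n\times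 n$ permutation matrices, and for $t>2$ a $t$-dimensional $0$--$1$ matrix is Latin if every slice of it is a $(t-1)$-dimensional Latin matrix. *)

(* Defs.v *)
From mathcomp Require Import all_boot all_fingroup.

Set Implicit Arguments.
Unset Strict Implicit.
Unset Printing Implicit Defensive.

(* Coordinates and indices are numbered from 0. *)
Definition index_tuple (t : nat) (m : 'I_t -> nat) : finType :=
  {dffun forall r : 'I_t, 'I_(m r)}.

Definition mat (t : nat) (m : 'I_t -> nat) : finType :=
  {ffun index_tuple m -> bool}.

Definition cube (t n : nat) : finType := mat (fun _ : 'I_t => n).

Definition is_pattern (t : nat) (k : 'I_t -> nat) (P : mat k) : Prop :=
  forall i j : index_tuple k, P i -> P j ->
    i = j \/ 2 <= #|[set r : 'I_t | i r != j r]|.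

(* Only the values of [c] on [S] matter. They are compared as natural numbers,
   so that [c] exists even when some side [k s] is 0. *)
Definition is_sunflower_pattern (t : nat) (k : 'I_t -> nat) (P : mat k) : Prop :=
  is_pattern P /\
  exists (S : {set 'I_t}) (c : 'I_t -> nat),
    forall i j : index_tuple k, P i -> P j -> i <> j ->
      (forall s, s \in S -> (i s = c s :> nat) /\ (j s = c s :> nat)) /\
      (forall s, s \notin S -> i s <> j s).

Definition selection (t : nat) (k m : 'I_t -> nat) : finType :=
  {dffun forall r : 'I_t, {ffun 'I_(k r) -> 'I_(m r)}}.

Definition increasing (t : nat) (k m : 'I_t -> nat) (sigma : selection k m) :
    bool :=
  [forall r : 'I_t, forall a : 'I_(k r), forall b : 'I_(k r),
    (a < b) ==> (sigma r a < sigma r b)].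

Definition submatrix (t : nat) (k m : 'I_t -> nat) (sigma : selection k m)
    (M : mat m) : mat k :=
  [ffun i : index_tuple k =>
    M (finfun (fun r : 'I_t => sigma r (i r)) : index_tuple m)].

Definition entrywise_le (t : nat) (k : 'I_t -> nat) (P Q : mat k) : bool :=
  [forall i : index_tuple k, P i ==> Q i].

Definition avoids (t : nat) (k m : 'I_t -> nat) (P : mat k) (M : mat m) : bool :=
  ~~ [exists sigma : selection k m,
        increasing sigma && entrywise_le P (submatrix sigma M)].

(* [insert_index r j y] has [j] in position [r]; the entries of [y] fill the
   remaining positions in order. *)
Definition insert_index (t n : nat) (r : 'I_t.+1) (j : 'I_n)
    (y : index_tuple (fun _ : 'I_t => n)) : index_tuple (fun _ : 'I_t.+1 => n) :=
  finfun (fun s : 'I_t.+1 => if unlift r s is Some s' then y s' else j).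

Definition slice (t n : nat) (r : 'I_t.+1) (j : 'I_n) (M : cube t.+1 n) :
    cube t n :=
  [ffun y : index_tuple (fun _ : 'I_t => n) => M (insert_index r j y)].

Definition is_permutation_matrix (n : nat) (M : cube 2 n) : bool :=
  [exists s : 'S_n, forall x : index_tuple (fun _ : 'I_2 => n),
    M x == (s (x ord0) == x ord_max)].

(* Recursion on the dimension minus 2. *)
Fixpoint is_latin_plus2 (n d : nat) : cube d.+2 n -> bool :=
  match d return cube d.+2 n -> bool with
  | 0 => fun M => is_permutation_matrix M
  | d'.+1 => fun M =>
      [forall r : 'I_d'.+3, forall j : 'I_n, is_latin_plus2 (slice r j M)]
  end.

(* Latin matrices only exist in dimension at least 2; the value in dimensions 0
   and 1 is a dummy. *)
Definition is_latin (t n : nat) : cube t n -> bool :=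
  match t return cube t n -> bool with
  | d.+2 => fun M => is_latin_plus2 M
  | _ => fun _ => false
  end.

(* Main.v *)
Require Import Defs.
From mathcomp Require Import all_boot all_fingroup.
From mathcomp Require Import zify ring.

Set Implicit Arguments.
Unset Strict Implicit.
Unset Printing Implicit Defensive.

(** Fixing the kernel coordinates of [P] cuts a matrix into slices of dimension
    [d >= 2], in which the petals form a partial [d]-dimensional permutation
    matrix; every slice away from the boundary avoids it, and the remaining slices
    have only [O(n^(t-1))] cells.

    For one slice, the Klazar-Marcus extension of the Marcus-Tardos theorem bounds
    the number of 1-entries by [O(n^(d-1))]: cut the slice into blocks of bounded
    side, bound the blocks that are wide in some direction by induction on the
    dimension, and the others by contracting each block to a single entry.
    Klazar's contraction of 2 x ... x 2 blocks turns this into the bound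
    [2^O(n^(d-1))] on the number of slices. *)

(** * Counting by fibres and boxes, and monotone embeddings *)

Lemma card_fibers (T T' : finType) (f : T -> T') (X : {set T}) (B : {set T'})
    (b : nat) :
  (forall x, x \in X -> f x \in B) ->
  (forall y, y \in B -> #|[set x in X | f x == y]| <= b) ->
  #|X| <= #|B| * b.
Proof.
move=> XB fib; rewrite -sum1_card (partition_big f (mem B)) //=.
rewrite -sum_nat_const; apply: leq_sum => y yB.
rewrite sum1dep_card; apply: leq_trans (fib y yB).
by apply: eq_leq; apply: eq_card => x; rewrite !inE.
Qed.

Lemma card_bigcup_le (I T : finType) (A : {set I}) (F : I -> {set T}) (b : nat) :
  (forall i, i \in A -> #|F i| <= b) -> #|\bigcup_(i in A) F i| <= #|A| * b.
Proof.
move=> Fb; rewrite -sum_nat_const.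
elim/big_rec2: _ => [|i n X iA IH]; first by rewrite cards0.
rewrite (leq_trans (leq_card_setU _ _)) //.
by apply: leq_add => //; apply: Fb.
Qed.

Lemma card_ord_lt (N m : nat) : #|[set c : 'I_N | c < m]| <= m.
Proof.
case: m => [|m].
  by rewrite (_ : [set _ | _] = set0) ?cards0 //; apply/setP => c; rewrite !inE.
rewrite -[X in _ <= X]card_ord.
apply: (@leq_card_in _ _ (fun c : 'I_N => inord c : 'I_m.+1)) => x y.
rewrite !inE => xm ym /(congr1 val) /=; rewrite !inordK // => e.
exact: val_inj.
Qed.

Lemma card_family_prod (I : finType) (T : finType) (F : I -> pred T) :
  #|[pred x : {ffun I -> T} | x \in family F]| = \prod_i #|F i|.
Proof.
rewrite (eq_card (_ : _ =i (family F : simpl_pred {ffun I -> T}))) //.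
by rewrite card_family foldrE big_map big_enum.
Qed.

Lemma card_box (I : finType) (N k : nat) (X : {set {ffun I -> 'I_N}}) :
  (forall r, #|[set x r | x : {ffun I -> 'I_N} in X]| <= k) ->
  #|X| <= k ^ #|I|.
Proof.
move=> Xk; set F := fun r => mem [set x r | x : {ffun I -> 'I_N} in X].
apply: (@leq_trans #|[pred x : {ffun I -> 'I_N} | x \in family F]|).
  apply/subset_leq_card/subsetP => x xX; rewrite inE; apply/forallP => r.
  by apply/imsetP; exists x.
by rewrite card_family_prod (leq_trans (leq_prod (fun r _ => Xk r))) ?prod_nat_const.
Qed.

Lemma enum_val_lt (q : nat) (K : {set 'I_q}) (a b : 'I_#|K|) :
  a < b -> (enum_val a : nat) < enum_val b.
Proof.
move=> ab; have [x0 _] : exists x0 : 'I_q, true by exists (enum_val a).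
have sz (c : 'I_#|K|) : c < size (enum K) by rewrite -cardE.
rewrite !(enum_val_nth x0).
rewrite -!(nth_map x0 0 val) ?sz //.
apply: (sorted_ltn_nth ltn_trans) => //; rewrite ?inE ?size_map //.
rewrite (subseq_sorted ltn_trans (_ : subseq _ (iota 0 q))) ?iota_ltn_sorted //.
by rewrite -val_enum_ord map_subseq // {1}/enum_mem -enumT /= filter_subseq.
Qed.

(** Send [j] to the element of [K] whose rank is the number of indices with smaller [h]. *)
Lemma monotone_embedding (J : finType) (h : J -> nat) (q : nat)
    (K : {set 'I_q}) :
  injective h -> #|J| <= #|K| ->
  exists2 g : J -> 'I_q,
    forall j, g j \in K & forall j j', h j < h j' -> g j < g j'.
Proof.
move=> hI JK; pose rk j := #|[set j' | h j' < h j]|.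
have rkK j : rk j < #|K|.
  apply: leq_trans JK; rewrite -cardsT; apply: proper_card.
  by rewrite properT; apply/eqP => /setP /(_ j); rewrite !inE ltnn.
exists (fun j => enum_val (Ordinal (rkK j))) => [j|j j' jj].
  exact: enum_valP.
apply: enum_val_lt => /=; apply: proper_card; apply/properP; split.
  by apply/subsetP => i; rewrite !inE => /ltn_trans; apply.
by exists j; rewrite !inE ?ltnn.
Qed.

(** * The Klazar-Marcus theorem and Klazar's counting *)

Section MarcusTardos.

Variables (I J : finType) (rho : I -> J -> nat).

(* The pattern is the set of points indexed by [J] with coordinates [rho]. *)
Definition contains (N : nat) (A : {set I}) (X : {set {ffun I -> 'I_N}}) : bool :=
  [exists f : {ffun J -> {ffun I -> 'I_N}},
    [forall j, f j \in X] &&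
    [forall r in A, forall j, forall j',
      (rho r j < rho r j') ==> (f j r < f j' r)]].

Lemma containsP (N : nat) (A : {set I}) (X : {set {ffun I -> 'I_N}}) :
  reflect (exists f : J -> {ffun I -> 'I_N}, (forall j, f j \in X) /\
    (forall r j j', r \in A -> rho r j < rho r j' -> f j r < f j' r))
    (contains A X).
Proof.
apply: (iffP existsP) => [[f /andP [/forallP fX /forall_inP fM]]|[f [fX fM]]].
  exists f; split => // r j j' rA.
  by move: (fM r rA) => /forallP/(_ j)/forallP/(_ j')/implyP.
exists (finfun f); apply/andP; split; first by apply/forallP => j; rewrite ffunE.
apply/forall_inP => r rA; apply/forallP => j; apply/forallP => j'.
by apply/implyP; rewrite !ffunE; apply: fM.
Qed.

(* Blocks keep coordinates in ['I_N], so that one type serves all scales. *)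
Definition divo (N q : nat) (a : 'I_N) : 'I_N :=
  Ordinal (leq_ltn_trans (leq_div a q) (ltn_ord a)).

Definition blk (N q : nat) (x : {ffun I -> 'I_N}) : {ffun I -> 'I_N} :=
  [ffun r => divo q (x r)].

Lemma blkE (N q : nat) (x : {ffun I -> 'I_N}) r : blk q x r = x r %/ q :> nat.
Proof. by rewrite ffunE. Qed.

Lemma lt_blk (N q : nat) (x y : {ffun I -> 'I_N}) r :
  blk q x r < blk q y r -> x r < y r.
Proof. by rewrite !blkE; apply: contraLR; rewrite -!leqNgt => /leq_div2r ->. Qed.

(** Any choice of one point per block works, since strict order of quotients forces strict order of
    coordinates. *)
Lemma contains_blk (N q : nat) (A : {set I}) (X : {set {ffun I -> 'I_N}}) :
  contains A [set blk q x | x in X] -> contains A X.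
Proof.
move=> /containsP [f [fX fM]].
have pre j : exists x, (x \in X) && (f j == blk q x).
  by have /imsetP [x xX ->] := fX j; exists x; rewrite xX eqxx.
pose g j := xchoose (pre j).
have gP j : g j \in X /\ f j = blk q (g j).
  by have /andP [gX /eqP] := xchooseP (pre j).
apply/containsP; exists g; split => [j|r j j' rA jj]; first by case: (gP j).
apply: (@lt_blk _ q); rewrite -(gP j).2 -(gP j').2; exact: fM.
Qed.

(** Offsets along [r] of the points of [X] in block [b]; reduced modulo [q], they can be compared
    between blocks. *)
Definition residues (N q : nat) (X : {set {ffun I -> 'I_N}})
    (b : {ffun I -> 'I_N}) (r : I) : {set 'I_q} :=
  [set a : 'I_q | [exists x in X, (blk q x == b) && (x r %% q == a)]].

Lemma card_block (N q k : nat) (X : {set {ffun I -> 'I_N}})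
    (b : {ffun I -> 'I_N}) :
  0 < q -> (forall r, #|residues q X b r| <= k) ->
  #|[set x in X | blk q x == b]| <= k ^ #|I|.
Proof.
case: q => // q _ Xk; apply: card_box => r.
rewrite -(@card_in_imset _ _ (fun a : 'I_N => inord (a %% q.+1) : 'I_q.+1)).
  apply: leq_trans (Xk r); apply/subset_leq_card/subsetP => c.
  case/imsetP => a /imsetP [x + ->] ->; rewrite !inE => /andP [xX xb].
  by apply/existsP; exists x; rewrite xX xb /= inordK ?ltn_mod.
move=> a a' /imsetP [x + ->] /imsetP [y + ->].
rewrite !inE => /andP [_ /eqP bx] /andP [_ /eqP by_] /(congr1 val).
rewrite /= !inordK ?ltn_mod // => e; apply: val_inj.
by rewrite /= (divn_eq (x r) q.+1) (divn_eq (y r) q.+1) e -!blkE bx by_.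
Qed.

Lemma card_block_trivial (N q : nat) (b : {ffun I -> 'I_N})
    (X : {set {ffun I -> 'I_N}}) :
  0 < q -> #|[set x in X | blk q x == b]| <= q ^ #|I|.
Proof.
move=> q0; apply: card_block => // r; apply: leq_trans (max_card _) _.
by rewrite card_ord.
Qed.

(** A lower-dimensional slice stays a subset of the full cube, so that induction on the dimension
    only shrinks [A]. *)
Definition constant_outside (N : nat) (A : {set I}) (X : {set {ffun I -> 'I_N}}) :=
  forall x y, x \in X -> y \in X -> forall r, r \notin A -> x r = y r.


Lemma contains_line (N : nat) (r : I) (X : {set {ffun I -> 'I_N}}) :
  injective (rho r) -> constant_outside [set r] X -> #|J| <= #|X| ->
  contains [set r] X.
Proof.
move=> rI cX JX; pose V := [set x r | x : {ffun I -> 'I_N} in X].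
have XV : #|V| = #|X|.
  apply: card_in_imset => x y xX yX e; apply/ffunP => s.
  have [->//|sr] := eqVneq s r.
  by apply: cX => //; rewrite inE.
have [||g gV gM] := @monotone_embedding J (rho r) N V => //; first by rewrite XV.
have pre j : exists x, (x \in X) && (g j == x r).
  by have /imsetP [x xX ->] := gV j; exists x; rewrite xX eqxx.
pose f j := xchoose (pre j).
have fP j : f j \in X /\ g j = f j r.
  by have /andP [fX /eqP] := xchooseP (pre j).
apply/containsP; exists f; split => [j|s j j' /set1P -> jj].
  by case: (fP j).
by rewrite -(fP j).2 -(fP j').2; apply: gM.
Qed.

(* If many blocks in one layer orthogonal to [r] have the same rich set of
   residues, a copy of the pattern among these blocks with direction [r]
   forgotten lifts to [X]: the residues supply the order in direction [r]. *)
Lemma contains_wide (N q : nat) (A : {set I}) (r : I)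
    (X Y : {set {ffun I -> 'I_N}}) (c : 'I_N) (K : {set 'I_q}) :
  injective (rho r) -> #|J| <= #|K| ->
  (forall b, b \in Y -> b r = c /\ residues q X b r = K) ->
  contains (A :\ r) Y -> contains A X.
Proof.
move=> rI JK YK /containsP [f [fY fM]].
have [||g gK gM] := @monotone_embedding J (rho r) q K => //.
have pre j : exists x, (x \in X) && ((blk q x == f j) && (x r %% q == g j)).
  have [_ e] := YK _ (fY j); have := gK j.
  by rewrite -e inE => /existsP.
pose h j := xchoose (pre j).
have hP j : [/\ h j \in X, blk q (h j) = f j & h j r %% q = g j].
  by have /and3P [hX /eqP ? /eqP ?] := xchooseP (pre j).
apply/containsP; exists h; split => [j|s j j' sA jj]; first by case: (hP j).
have [_ bj mj] := hP j; have [_ bj' mj'] := hP j'.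
have [e|sr] := eqVneq s r; last first.
  by apply: (@lt_blk _ q); rewrite bj bj'; apply: fM => //; rewrite !inE sr.
rewrite {}e in jj *.
rewrite (divn_eq (h j r) q) (divn_eq (h j' r) q) mj mj' -!blkE bj bj'.
by rewrite (YK _ (fY j)).1 (YK _ (fY j')).1 ltn_add2l gM.
Qed.

Lemma card_constant_image (N : nat) (T : finType) (X : {set {ffun I -> 'I_N}})
    (h : {ffun I -> 'I_N} -> T) :
  (forall x y, x \in X -> y \in X -> h x = h y) -> #|[set h x | x in X]| <= 1.
Proof.
move=> hX; apply/card_le1_eqP => a b /imsetP [x xX ->] /imsetP [y yX ->].
exact: hX.
Qed.

Lemma constant_outside_blk (N q : nat) (A : {set I}) (X : {set {ffun I -> 'I_N}}) :
  constant_outside A X -> constant_outside A [set blk q x | x in X].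
Proof.
move=> cX _ _ /imsetP [x xX ->] /imsetP [y yX ->] r rA.
by apply: val_inj; rewrite /= !blkE (cX x y).
Qed.

(** Closes the induction on [n], with [p] points per narrow block and [E * m ^ e] points in wide
    ones: [C * p + E <= 2 * C * p <= C * (2 * p) ^ e], while [m <= n / (2 * p)]. *)
Lemma contraction_bound (p m n e a C E : nat) :
  0 < p -> 0 < e -> 4 * p * m <= 2 * n -> E <= C ->
  a <= C * m ^ e * p + E * m ^ e -> a <= C * n ^ e.
Proof.
move=> p0 e0 mn EC ab.
have q0 : 0 < (4 * p) ^ e by rewrite expn_gt0 muln_gt0 p0.
rewrite -(leq_pmul2l q0).
apply: (@leq_trans ((C * p + E) * (2 * n) ^ e)).
  apply: (@leq_trans ((C * p + E) * (4 * p * m) ^ e)).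
    by rewrite (expnMn _ m) mulnCA leq_mul2l (leq_trans ab) ?orbT // mulnDl mulnAC.
  by rewrite leq_mul2l leq_exp2r // mn orbT.
rewrite expnMn mulnA [X in _ <= X]mulnA leq_mul2r; apply/orP; right.
have -> : 4 * p = 2 * (2 * p) by rewrite mulnA.
rewrite expnMn [_ * C]mulnC mulnCA [X in X <= _]mulnC leq_mul2l; apply/orP; right.
have h : 2 * p <= (2 * p) ^ e.
  by rewrite -{1}[2 * p]expn1 leq_pexp2l // muln_gt0 p0.
apply: (@leq_trans (C * (2 * p))); last by rewrite leq_mul2l h orbT.
rewrite mulnCA mul2n -addnn leq_add2l (leq_trans EC) //.
by rewrite leq_pmulr.
Qed.

Lemma card_residues_outside (N q : nat) (A : {set I}) (r : I)
    (X : {set {ffun I -> 'I_N}}) (b : {ffun I -> 'I_N}) :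
  constant_outside A X -> r \notin A -> #|residues q X b r| <= 1.
Proof.
move=> cX rA; apply/card_le1_eqP => a a'; rewrite !inE.
move=> /existsP [x /and3P [xX _ /eqP ax]] /existsP [y /and3P [yX _ /eqP ay]].
by apply: val_inj; rewrite /= -ax -ay (cX x y).
Qed.

(** Induction on the dimension, then strong induction on [n], the side in the directions of [A],
    with [N] fixed. A point is narrow if its block has at most [k] residues in each direction of
    [A]; otherwise it is wide in some direction. *)
Lemma marcus_tardos (d : nat) : exists C, forall N n (A : {set I})
    (X : {set {ffun I -> 'I_N}}),
  #|A| = d.+1 -> {in A, forall r, injective (rho r)} -> 0 < n ->
  constant_outside A X -> (forall x r, x \in X -> r \in A -> x r < n) ->
  ~~ contains A X -> #|X| <= C * n ^ d.
Proof.
elim: d => [|d [C IH]].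
  exists #|J| => N n A X /eqP/cards1P [r ->] rI _ cX _.
  rewrite muln1; apply: contraR; rewrite -ltnNge => /ltnW; apply: contains_line => //.
  by apply: rI; rewrite inE.
(* Wide blocks have at least [k > #|J|] residues, enough for [contains_wide]; [q] is the side that
   [contraction_bound] wants for [p = k ^ s]. The factors of [E] count directions, residue sets,
   blocks per group (up to a power of [m]) and cells per block. *)
set s := #|I|; set k := #|J|.+1; pose q := 4 * k ^ s.
pose E := d.+2 * (2 ^ q * C * q ^ s).
have q0 : 0 < q by rewrite muln_gt0 expn_gt0.
exists (E + q ^ s) => N n; elim/ltn_ind: n => n IHn A X cardA rI n0 cX Xn XA.
(* For [n < q] all points fit in a box of at most [q ^ s] cells, whence that summand of the
   constant; from [q] on, contraction strictly shrinks the side. *)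
have [nq|qn] := ltnP n q.
  apply: (@leq_trans (q ^ s)); last first.
    by rewrite -[q ^ s]muln1 leq_mul ?expn_gt0 ?n0 // muln1 leq_addl.
  apply: card_box => r; have [rA|rA] := boolP (r \in A).
    apply: leq_trans (ltnW nq); apply: leq_trans (card_ord_lt N n).
    apply/subset_leq_card/subsetP => _ /imsetP [x xX ->].
    by rewrite inE; apply: Xn.
  by apply: leq_trans (card_constant_image _) q0 => // x y xX yX; apply: cX.
pose m := (n %/ q).+1.
have m0 : 0 < m by [].
have q4 : 4 <= q by rewrite leq_pmulr // expn_gt0.
have qm : q * m <= 2 * n.
  by rewrite mulnS mul2n -addnn leq_add // mulnC leq_divM.
have mn : m < n by nia.
pose B := [set blk q x | x in X].
have Bm b r : b \in B -> r \in A -> b r < m.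
  move=> /imsetP [x xX ->] rA; rewrite blkE ltnS.
  by apply: leq_div2r; apply/ltnW/Xn.
have BA : ~~ contains A B by apply: contra XA; apply: contains_blk.
have cB : constant_outside A B by apply: constant_outside_blk.
have cardB := IHn m mn A B cardA rI m0 cB Bm BA.
pose wide r := [set x in X | k <= #|residues q X (blk q x) r|].
pose narrow := [set x in X | [forall r in A, #|residues q X (blk q x) r| <= k]].
have XU : X \subset narrow :|: \bigcup_(r in A) wide r.
  apply/subsetP => x xX; rewrite !inE xX /=.
  case: (boolP [forall r in A, _]) => //= /forall_inPn [r rA /=].
  rewrite -ltnNge => /ltnW kr.
  by apply/bigcupP; exists r => //; rewrite inE xX.
have cn : #|narrow| <= #|B| * k ^ s.
  apply: (@card_fibers _ _ (blk q)) => [x|b bB].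
    by rewrite inE => /andP [xX _]; apply: imset_f.
  set F := [set x in narrow | _]; have [->|[x]] := set_0Vmem F.
    by rewrite cards0.
  rewrite !inE => /andP [/andP [_ /forall_inP bk] /eqP xb].
  apply: (@leq_trans #|[set x in X | blk q x == b]|).
    by apply/subset_leq_card/subsetP => y; rewrite !inE => /andP [/andP [-> _] ->].
  apply: card_block => // r; have [rA|rA] := boolP (r \in A).
    by rewrite -xb; apply: bk.
  exact: leq_trans (card_residues_outside _ _ cX rA) _.
(* Wide blocks are grouped by layer [b r] and residue set, in at most [m * 2 ^ q] groups. By
   [contains_wide], each group avoids the pattern with direction [r] dropped, so [IH] applies to
   it. *)
have cw r : r \in A -> #|wide r| <= m * 2 ^ q * (C * m ^ d) * q ^ s.
  move=> rA; pose W := [set b in B | k <= #|residues q X b r|].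
  have cW : #|W| <= m * 2 ^ q * (C * m ^ d).
    pose L := setX [set c : 'I_N | c < m] [set: {set 'I_q}].
    have cL : #|L| <= m * 2 ^ q.
      rewrite cardsX leq_mul ?card_ord_lt // cardsT.
      by rewrite (eq_card (_ : _ =i powerset [set: 'I_q])) ?card_powerset
        ?cardsT ?card_ord // => K; rewrite powersetE subsetT.
    apply: (@leq_trans (#|L| * (C * m ^ d))); last by rewrite leq_mul2r cL orbT.
    apply: (@card_fibers _ _ (fun b : {ffun I -> 'I_N} => (b r, residues q X b r))).
      by move=> b; rewrite !inE andbT => /andP [bB _] /=; apply: Bm.
    move=> [c K] _; set Y := [set x in W | _].
    have [->|[b0]] := set_0Vmem Y; first by rewrite cards0.
    rewrite inE [b0 \in W]inE => /andP [/andP [_ kK] /eqP [_ eK]].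
    have YB b : b \in Y -> [/\ b \in B, b r = c & residues q X b r = K].
      by rewrite inE [b \in W]inE => /andP [/andP [bB _] /eqP [-> ->]].
    apply: (IH N m (A :\ r)) => //.
    - by apply: succn_inj; rewrite -cardA (cardsD1 r A) rA.
    - by move=> r' /setD1P [_ r'A]; apply: rI.
    - move=> x y xY yY r'; rewrite !inE negb_and negbK.
      have [xB xc _] := YB _ xY; have [yB yc _] := YB _ yY.
      by case/orP => [/eqP -> | r'A]; [rewrite xc yc | apply: cB].
    - by move=> x r' /YB [xB _ _] /setD1P [_ r'A]; apply: Bm.
    apply: contra XA; apply: (@contains_wide _ q A r X Y c K); first exact: rI.
      by rewrite -eK; apply: ltnW.
    by move=> b /YB [].
  apply: (@leq_trans (#|W| * q ^ s)); last by rewrite leq_mul2r cW orbT.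
  apply: (@card_fibers _ _ (blk q)) => [x|b bW].
    by rewrite !inE => /andP [xX ->]; rewrite imset_f.
  apply: leq_trans (card_block_trivial b X q0).
  by apply/subset_leq_card/subsetP => y; rewrite !inE => /andP [/andP [-> _] ->].
apply: (@contraction_bound (k ^ s) m n d.+1 _ _ E) => //.
- by rewrite expn_gt0.
- exact: leq_addr.
apply: leq_trans (subset_leq_card XU) _.
apply: leq_trans (leq_card_setU _ _) _; apply: leq_add.
  by apply: leq_trans cn _; rewrite leq_mul2r cardB orbT.
apply: leq_trans (card_bigcup_le cw) _.
rewrite cardA /E expnS; apply: eq_leq; ring.
Qed.

(** The slice is pinned by [v] outside [A]; keeping [n] apart from [N] lets halving stay in one
    type. *)
Definition slice_avoiders (N n : nat) (A : {set I}) (v : {ffun I -> 'I_N}) :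
    {set {set {ffun I -> 'I_N}}} :=
  [set X : {set {ffun I -> 'I_N}} |
    [forall x in X, forall r, if r \in A then x r < n else x r == v r] &&
    ~~ contains A X].

Lemma slice_avoidersP (N n : nat) (A : {set I}) (v : {ffun I -> 'I_N})
    (X : {set {ffun I -> 'I_N}}) :
  reflect [/\ forall x r, x \in X -> r \in A -> x r < n,
              forall x r, x \in X -> r \notin A -> x r = v r & ~~ contains A X]
    (X \in slice_avoiders n A v).
Proof.
rewrite inE; apply: (iffP andP) => [[/forall_inP h XA]|[hn hv XA]]; split => //.
- by move=> x r xX rA; have /forallP/(_ r) := h x xX; rewrite rA.
- move=> x r xX rA; have /forallP/(_ r) := h x xX; rewrite (negPf rA).
  by move/eqP.
apply/forall_inP => x xX; apply/forallP => r; case: ifPn => rA; first exact: hn.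
by apply/eqP/hv.
Qed.

Lemma slice_avoiders_constant (N n : nat) (A : {set I}) (v : {ffun I -> 'I_N})
    (X : {set {ffun I -> 'I_N}}) :
  X \in slice_avoiders n A v -> constant_outside A X.
Proof. by case/slice_avoidersP => _ hv _ x y xX yX r rA; rewrite !hv. Qed.

Lemma slice_avoiders_blk (N n : nat) (A : {set I}) (v : {ffun I -> 'I_N})
    (X : {set {ffun I -> 'I_N}}) :
  X \in slice_avoiders n A v ->
  [set blk 2 x | x in X] \in slice_avoiders (uphalf n) A (blk 2 v).
Proof.
case/slice_avoidersP => hn hv XA; apply/slice_avoidersP; split.
- move=> _ r /imsetP [x xX ->] rA; rewrite blkE; move: (hn x r xX rA).
  by move: (nat_of_ord (x r)) => a; lia.
- move=> _ r /imsetP [x xX ->] rA; apply: val_inj.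
  by rewrite /= !blkE (hv x r).
by apply: contra XA; apply: contains_blk.
Qed.

(** The ratio [2 / 3], attained at [n = 3] for exponent 1, makes the halving recurrence
    geometric. *)
Lemma uphalf_expn (n e : nat) : 1 < n -> 3 * uphalf n ^ e.+1 <= 2 * n ^ e.+1.
Proof.
move=> n1; rewrite !expnS !mulnA leq_mul //; first lia.
have un : uphalf n <= n by lia.
by case: e => // e; rewrite leq_exp2r.
Qed.

(* Halving the side of the cube: the contracted set has few points by
   [marcus_tardos], and each of them comes from boundedly many cells. *)
Lemma card_slice_avoiders (A : {set I}) (d : nat) :
  #|A| = d.+2 -> {in A, forall r, injective (rho r)} ->
  exists D, forall N n (v : {ffun I -> 'I_N}), 0 < n ->
    #|slice_avoiders n A v| <= D ^ (n ^ d.+1).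
Proof.
move=> cardA rI; have [C MT] := marcus_tardos d.+1.
(* With [a = 2 * E + 1], the recurrence needs [(a + E) * m ^ d.+1 <= a * n ^ d.+1]; the ratio
   [2 / 3] yields it because [2 * (3 * E + 1) <= 3 * a]. The extra 1 covers the single cell at
   [n = 1]. *)
pose E := C * 2 ^ #|I|; exists (2 ^ (2 * E).+1) => N n.
elim/ltn_ind: n => n IHn v n0.
have [n1|n1] := leqP n 1.
  have {n0 n1 IHn}-> : n = 1 by lia.
  pose box := [set x : {ffun I -> 'I_N} |
    [forall r, if r \in A then x r < 1 else x r == v r]].
  apply: (@leq_trans #|powerset box|).
    apply/subset_leq_card/subsetP => X; rewrite !inE => /andP [/forall_inP h _].
    by apply/subsetP => x xX; rewrite inE; apply: h.
  rewrite card_powerset exp1n expn1 leq_exp2l //.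
  apply: (@leq_trans (1 ^ #|I|)); last by rewrite exp1n.
  apply: card_box => r; apply: card_constant_image => x y; rewrite !inE.
  move=> /forallP/(_ r) + /forallP/(_ r); case: ifP => _; last by move=> /eqP-> /eqP->.
  by move=> x0 y0; apply: val_inj => /=; lia.
pose m := uphalf n.
have mn : m < n by rewrite /m; lia.
have m0 : 0 < m by rewrite /m; lia.
apply: (@leq_trans (#|slice_avoiders m A (blk 2 v)| * 2 ^ (E * m ^ d.+1))).
  apply: (@card_fibers _ _ (fun X : {set {ffun I -> 'I_N}} => [set blk 2 x | x in X])).
    by move=> X; apply: slice_avoiders_blk.
  move=> Y Yav; pose Z := [set x | blk 2 x \in Y].
  apply: (@leq_trans #|powerset Z|).
    apply/subset_leq_card/subsetP => X; rewrite inE => /andP [_ /eqP e].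
    by rewrite powersetE; apply/subsetP => x xX; rewrite inE -e imset_f.
  rewrite card_powerset leq_exp2l //.
  have cY := slice_avoiders_constant Yav.
  have /slice_avoidersP [Yn _ YA] := Yav.
  have := MT N m A Y cardA rI m0 cY Yn YA => cardY.
  apply: (@leq_trans (#|Y| * 2 ^ #|I|)); last first.
    by rewrite /E mulnAC leq_mul2r cardY orbT.
  apply: (@card_fibers _ _ (blk 2)) => [x|b _]; first by rewrite inE.
  exact: card_block_trivial.
apply: (@leq_trans ((2 ^ (2 * E).+1) ^ (m ^ d.+1) * 2 ^ (E * m ^ d.+1))).
  by rewrite leq_mul2r IHn ?orbT.
rewrite -!expnM -expnD leq_exp2l //.
have := uphalf_expn d n1; rewrite -/m; nia.
Qed.

End MarcusTardos.

(** * Slicing along the kernel *)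

(** With two distinct 1-entries the given [S] and [c] serve, and the positions where these entries
    differ lie outside [S]. With at most one 1-entry, the empty kernel works because [t >= 2]. *)
Lemma sunflower_kernel (t : nat) (k : 'I_t -> nat) (P : mat k) :
  2 <= t -> is_sunflower_pattern P ->
  exists (S : {set 'I_t}) (c : 'I_t -> nat),
    [/\ forall (i : index_tuple k) s, P i -> s \in S -> i s = c s :> nat,
        forall (i j : index_tuple k) s, P i -> P j -> s \notin S -> i s = j s -> i = j &
        2 <= #|~: S|].
Proof.
move=> t2 [Ppat [S [c PS]]].
have [/existsP [i /existsP [j /and3P [Pi Pj /eqP ij]]]|h] :=
  boolP [exists i : index_tuple k, exists j : index_tuple k, [&& P i, P j & i != j]].
  exists S, c; split.
  - move=> i' s Pi' sS; have [e|/eqP i'i] := eqVneq i' i.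
      by have [/(_ s sS) []] := PS i j Pi Pj ij; rewrite e.
    by have [/(_ s sS) []] := PS i' i Pi' Pi i'i.
  - move=> i' j' s Pi' Pj' sS e; have [//|/eqP d] := eqVneq i' j'.
    by have [_ /(_ s sS)] := PS i' j' Pi' Pj' d.
  have [//|h] := Ppat i j Pi Pj; apply: leq_trans h _.
  apply/subset_leq_card/subsetP => s; rewrite !inE => /eqP sij.
  by apply/negP => sS; have [/(_ s sS) [a b] _] := PS i j Pi Pj ij;
     apply/sij/val_inj; rewrite /= a b.
exists set0, c; split.
- by move=> i s _; rewrite inE.
- move=> i j s Pi Pj _ _; apply/eqP; apply: contraR h => ij.
  by apply/existsP; exists i; apply/existsP; exists j; rewrite Pi Pj ij.
by rewrite setC0 cardsT card_ord.
Qed.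

Section KernelSlices.

Variables (t : nat) (k : 'I_t -> nat) (P : mat k) (S : {set 'I_t}) (c : 'I_t -> nat).

Hypothesis kernelP : forall (i : index_tuple k) s, P i -> s \in S -> i s = c s :> nat.
Hypothesis petalP : forall (i j : index_tuple k) s,
  P i -> P j -> s \notin S -> i s = j s -> i = j.

Let K := (\max_(r < t) k r).+1.

Let k_lt (r : 'I_t) : k r < K.
Proof. by rewrite ltnS (leq_bigmax r). Qed.

(** As [K] exceeds every side of [P], the last index of ['I_K] is missed in each direction, so each
    direction contributes an extra point. *)
Definition unused (p : 'I_t * 'I_K) : bool :=
  ~~ [exists i : index_tuple k, P i && (i p.1 == p.2 :> nat)].

(* Each hyperplane of [P] that misses the 1-entries receives an extra point, with
   new values, at least [K], in the other directions: a copy of the enlarged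
   pattern also determines where the empty hyperplanes of [P] go. *)
Definition padded : finType := ({i : index_tuple k | P i} + {p | unused p})%type.

Definition position (r : 'I_t) (j : padded) : nat :=
  match j with
  | inl i => val i r
  | inr p => if (val p).1 == r then (val p).2 : nat else K + enum_rank (val p)
  end.

Lemma position_inj (r : 'I_t) : r \notin S -> injective (position r).
Proof.
have lt_K (i : {i : index_tuple k | P i}) : val i r < K.
  exact: ltn_trans (ltn_ord _) (k_lt r).
have inlr (i : {i : index_tuple k | P i}) (p : {p | unused p}) :
    position r (inl i) <> position r (inr p).
  rewrite /=; case: eqP => [pr e|_ e]; last by have := lt_K i; rewrite e; lia.
  case: p pr e => [[r' a] /= /existsP h] e; rewrite {}e in h * => e.
  by apply: h; exists (val i); rewrite (valP i) /= e.
move=> rS [i|p] [i'|p'] // e.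
- by congr inl; apply: val_inj; apply: (petalP (valP i) (valP i') rS); apply: val_inj.
- by case: (inlr i p').
- by case: (inlr i' p).
congr inr; apply: val_inj; move: e => /=.
case: (val p) => r1 a; case: (val p') => r2 b /=.
case: eqP => [->|_]; case: eqP => [->|_] e.
- by congr pair; apply: val_inj.
- by have := ltn_ord a; lia.
- by have := ltn_ord b; lia.
by apply: enum_rank_inj; apply: val_inj; move/eqP: e; rewrite eqn_add2l => /eqP.
Qed.

Lemma position_surj (r : 'I_t) (a : 'I_(k r)) : exists j, position r j == a.
Proof.
have aK := ltn_trans (ltn_ord a) (k_lt r).
have [/existsP [i /andP [Pi e]]|h] :=
  boolP [exists i : index_tuple k, P i && (i r == Ordinal aK :> nat)].
  by exists (inl (exist _ i Pi)).
have u : unused (r, Ordinal aK) by [].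
by exists (inr (exist (fun p => unused p) _ u)); rewrite /= eqxx.
Qed.

Lemma padded_inhabited (r : 'I_t) : exists j : padded, true.
Proof.
have u : unused (r, ord_max).
  apply/existsP => -[i /andP [_ /eqP /= e]].
  by have := ltn_ord (i r); rewrite e ltnNge -ltnS k_lt.
by exists (inr (exist (fun p => unused p) _ u)).
Qed.

(** Leaves room around [v s] for all hyperplanes of [P] in a kernel direction. *)
Definition interior (n : nat) (v : {ffun 'I_t -> 'I_n}) : bool :=
  [forall s in S, (K <= v s) && (v s + K < n)].

Definition support (n : nat) (M : cube t n) : {set {ffun 'I_t -> 'I_n}} :=
  [set x : {ffun 'I_t -> 'I_n} | M x].

Lemma contains_padded (n : nat) (M : cube t n.+1) (v : {ffun 'I_t -> 'I_n.+1})
    (X : {set {ffun 'I_t -> 'I_n.+1}}) :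
  X \subset support M -> (forall x s, x \in X -> s \in S -> x s = v s) ->
  interior v -> contains position (~: S) X -> ~~ avoids P M.
Proof.
move=> XM Xv vint /containsP [f [fX fM]]; rewrite negbK.
(* In a kernel direction the indices of [P] become consecutive ones, with [c r] landing on [v r]; in
   another direction, [a] goes to the coordinate of a point of the copy whose position is [a]. *)
pose sigma : selection k (fun _ => n.+1) := finfun (fun r : 'I_t =>
  [ffun a : 'I_(k r) => if r \in S then inord (v r - c r + a)
    else f (xchoose (position_surj a)) r]).
apply/existsP; exists sigma; apply/andP; split.
  apply/forallP => r; apply/forallP => a; apply/forallP => b; apply/implyP => ab.
  rewrite /sigma ffunE !ffunE; case: ifPn => rS.
    have /forall_inP /(_ r rS) := vint.
    have := ltn_ord b; have := k_lt r => ? ? ?.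
    rewrite !inordK; lia.
  apply: fM; first by rewrite inE.
  by rewrite !(eqP (xchooseP (position_surj _))).
apply/forallP => i; apply/implyP => Pi.
have := fX (inl (exist _ i Pi)) => /[dup] fiX /(subsetP XM); rewrite inE ffunE.
congr (is_true (M _)); apply/ffunP => r; rewrite ffunE /sigma ffunE ffunE.
case: ifPn => rS; last first.
  congr (f _ r); apply: (position_inj rS).
  by rewrite (eqP (xchooseP (position_surj _))).
rewrite (Xv _ _ fiX rS) (kernelP Pi rS) subnK ?inord_val //.
(* A 1-entry gives [c r < k r < K <= v r], so the truncated subtraction is exact. *)
have /forall_inP /(_ r rS) /andP [+ _] := vint.
have := ltn_ord (i r); rewrite (kernelP Pi rS); have := k_lt r; lia.
Qed.

Lemma card_near_ends (n : nat) :
  #|[set a : 'I_n.+1 | (a < K) || (n < a + K)]| <= 2 * K.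
Proof.
apply: (@leq_trans #|[set (inord i : 'I_n.+1) | i : 'I_K] :|:
                     [set (inord (n - i) : 'I_n.+1) | i : 'I_K]|).
  apply/subset_leq_card/subsetP => a; rewrite !inE => /orP [aK|aK].
    by apply/orP; left; apply/imsetP; exists (Ordinal aK); rewrite //= inord_val.
  have naK : n - a < K by have := ltn_ord a; lia.
  apply/orP; right; apply/imsetP; exists (Ordinal naK) => //=.
  by rewrite subKn ?inord_val // -ltnS.
apply: leq_trans (leq_card_setU _ _) _; rewrite mul2n -addnn.
by apply: leq_add; apply: leq_trans (leq_imset_card _ _) _; rewrite card_ord.
Qed.

(** An exterior cell lies in one of [t] slabs of thickness at most [2 * K]. *)
Lemma card_exterior (n : nat) :
  #|[set x : {ffun 'I_t -> 'I_n.+1} | ~~ interior x]| <=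
  2 * t * K * n.+1 ^ (t - 1).
Proof.
pose ends := [set a : 'I_n.+1 | (a < K) || (n < a + K)].
pose slab s := [set x : {ffun 'I_t -> 'I_n.+1} | x s \in ends].
apply: (@leq_trans #|\bigcup_(s in [set: 'I_t]) slab s|).
  apply/subset_leq_card/subsetP => x; rewrite inE => /forall_inPn [s sS h].
  apply/bigcupP; exists s => //; rewrite !inE; move: h; rewrite /=; lia.
apply: leq_trans (card_bigcup_le (b := 2 * K * n.+1 ^ (t - 1)) _) _; last first.
  by rewrite cardsT card_ord; apply: eq_leq; ring.
move=> s _.
pose F r : pred 'I_n.+1 := fun a => (r == s) ==> (a \in ends).
rewrite (eq_card (_ : _ =i [pred x : {ffun 'I_t -> 'I_n.+1} | x \in family F])).
  rewrite card_family_prod (bigD1 s) //=; apply: leq_mul.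
    rewrite (eq_card (_ : _ =i ends)); first exact: card_near_ends.
    by move=> a; rewrite /F unfold_in eqxx.
  rewrite (eq_bigr (fun _ => n.+1)) => [|r rs].
    by rewrite prod_nat_const cardC1 card_ord subn1.
  by rewrite -[RHS]card_ord; apply: eq_card => a; rewrite /F unfold_in (negPf rs).
move=> x; rewrite !inE; apply/idP/forallP => [h r|/(_ s)].
  by rewrite unfold_in /F; case: eqP => [->|//]; rewrite !inE.
by rewrite unfold_in /F eqxx !inE.
Qed.

(** A matrix is coded by its exterior support, an arbitrary set of cells, and its interior part in
    each slice. There are [n.+1 ^ #|S|] slices, and [#|S| + d.+1 = t - 1]. *)
Lemma card_avoiding (n D d : nat) :
  0 < t -> t = d.+2 + #|S| ->
  (forall v : {ffun 'I_t -> 'I_n.+1},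
    #|slice_avoiders position n.+1 (~: S) v| <= D ^ (n.+1 ^ d.+1)) ->
  #|[set M : cube t n.+1 | avoids P M]| <= (2 ^ (2 * t * K) * D) ^ (n.+1 ^ (t - 1)).
Proof.
move=> t0 tE sD.
pose U := {ffun 'I_t -> 'I_n.+1}.
pose V := [set v : U | v \in pffun_on ord0 (mem S) predT].
(* Zeroing the coordinates outside [S] gives each slice one representative in [V]; at any other
   index the part is empty, so [F] leaves one choice there. *)
pose base (x : U) : U := [ffun r => if r \in S then x r else ord0].
pose part (M : cube t n.+1) (v : U) : {set U} :=
  [set x in support M | interior x && (base x == v)].
pose h (M : cube t n.+1) : {set U} * {ffun U -> {set U}} :=
  ([set x in support M | ~~ interior x], [ffun v => part M v]).
pose F (v : U) : pred {set U} := fun X =>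
  if v \in V then X \in slice_avoiders position n.+1 (~: S) v else X == set0.
pose G := [set g : {ffun U -> {set U}} | g \in family F].
pose ext := [set x : U | ~~ interior x].
have hI : injective h.
  move=> M M' [/setP e1 /ffunP e2]; apply/ffunP => x.
  have := e1 x; have := e2 (base x); rewrite !ffunE => /setP/(_ x).
  by rewrite !inE eqxx andbT; case: (interior x); rewrite ?andbT ?andbF.
have cG : #|G| <= (D ^ (n.+1 ^ d.+1)) ^ (n.+1 ^ #|S|).
  rewrite (eq_card (_ : _ =i [pred g : {ffun U -> {set U}} | g \in family F])); last first.
    by move=> g; rewrite !inE.
  rewrite card_family_prod (bigID (mem V)) /= [X in _ * X]big1 ?muln1; last first.
    move=> v vV; rewrite -(card1 (set0 : {set U})); apply: eq_card => X.
    by rewrite unfold_in /F (negPf vV) inE.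
  apply: (@leq_trans (\prod_(v in V) D ^ (n.+1 ^ d.+1))).
    apply: leq_prod => v vV; apply: leq_trans (sD v); apply: eq_leq.
    by apply: eq_card => X; rewrite unfold_in /F vV.
  rewrite prod_nat_const leq_eqVlt; apply/orP; left; apply/eqP; congr (_ ^ _).
  by rewrite cardsE card_pffun_on cardT size_enum_ord.
rewrite -(card_imset _ hI).
apply: (@leq_trans #|setX (powerset ext) G|).
  apply/subset_leq_card/subsetP => _ /imsetP [M + ->]; rewrite inE => MP.
  rewrite in_setX /= powersetE; apply/andP; split.
    by apply/subsetP => x; rewrite !inE => /andP [].
  rewrite inE; apply/forallP => v; rewrite ffunE unfold_in /F.
  have partv x s : x \in part M v -> s \in S -> x s = v s.
    by rewrite !inE => /and3P [_ _ /eqP <-] sS; rewrite ffunE sS.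
  case: ifPn => vV; last first.
    apply: contraR vV => /set0Pn [x].
    rewrite !inE => /and3P [_ _ /eqP <-]; apply/pffun_onP; split => //.
    apply/supportP => r rS; by rewrite ffunE (negPf rS).
  apply/slice_avoidersP; split => [x r _ _|x r xM|].
  - exact: ltn_ord.
  - by rewrite inE negbK; apply: partv.
  apply: contraL MP => cont.
  apply: (@contains_padded n M v (part M v)) => //.
    by apply/subsetP => x; rewrite inE => /andP [].
  (* The copy has a point; it is interior and agrees with [v] on [S], so [v] is interior. *)
  have /containsP [f [fX _]] := cont; have [j _] := padded_inhabited (Ordinal t0).
  have := fX j; rewrite inE => /and3P [_ /forall_inP fint _].
  by apply/forall_inP => s sS; rewrite -(partv _ s (fX j) sS); apply: fint.
rewrite cardsX card_powerset expnMn -expnM leq_mul //.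
  by rewrite leq_exp2l //; apply: card_exterior.
apply: leq_trans cG _; rewrite -!expnM -expnD.
by apply: eq_leq; congr (_ ^ (_ ^ _)); lia.
Qed.

End KernelSlices.

Theorem theorem2 (t : nat) (ht : 2 <= t) (k : 'I_t -> nat) (P : mat k)
    (hP : is_sunflower_pattern P) :
  exists c : nat, forall n : nat,
    #|[set M : cube t n | is_latin M && avoids P M]| <= c ^ (n ^ (t - 1)).
Proof.
have [S [c [kerP petP cardS]]] := sunflower_kernel ht hP.
pose d := #|~: S| - 2.
have cardA : #|~: S| = d.+2 by rewrite /d; lia.
have tE : t = d.+2 + #|S| by rewrite -cardA addnC cardsC card_ord.
have [|D sD] := @card_slice_avoiders _ _ (@position t k P) (~: S) d cardA.
  by move=> r; rewrite inE => rS; apply: (position_inj petP rS).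
exists (2 ^ (2 * t * (\max_(r < t) k r).+1) * D) => -[|n]; last first.
  apply: leq_trans (card_avoiding kerP petP _ tE (fun v => sD n.+1 n.+1 v _)).
  - by apply/subset_leq_card/subsetP => M; rewrite !inE => /andP [].
  - by lia.
  - by [].
(* At side 0 there are no index tuples, hence only one matrix, and the exponent is 0. *)
rewrite exp0n ?expn0; last by lia.
apply: leq_trans (max_card _) _.
rewrite card_ffun card_bool.
suff -> : #|index_tuple (fun _ : 'I_t => 0)| = 0 by [].
apply/eqP/pred0P => x.
by case: (x (Ordinal (ltnW ht))).
Qed.
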